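(* Suppose $T\ge 3$ and that there exist two distinct routes $i,j\in[M]$ and a day $t\in\{1,\dots,T-2\}$ such that $\Delta c_t(i,j)\neq \Delta V_1(i,j)$, where $\Delta c_t(i,j)=c_t(i)-c_t(j)$ and $\Delta V_1(i,j)=V_1(i)-V_1(j)$. Then the pooled day-to-day choice model with parameters $(\eta,\theta,\rho)$ is identifiable: if $(\eta,\theta,\rho)$ and $(\eta',\theta',\rho')$ are two parameter triples in $(0,1)\times(0,\infty)\times(0,1)$ such that $$P(X_{1:T}=x_{1:T}\mid \eta,\theta,\rho,c_{1:T})=P(X_{1:T}=x_{1:T}\mid \eta',\theta',\rho',c_{1:T})\quad\text{for all } x_{1:T}\in\{0,1,\dots,M\}^{T\times N},$$ then $\eta=\eta'$, $\theta=\theta'$ and $\rho=\rho'$.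
   Context: Notation: $[K]=\{1,\dots,K\}$. There are $N\ge 1$ commuters, $M\ge 1$ physical paths and $T\ge1$ days. The travel costs $c_t(i)\in\mathbb{R}$, $i\in[M]$, $t\in[T]$, are exogenously given and bounded by a finite constant: $|c_t(i)|\le C$; $c_{1:T}$ denotes the whole cost sequence. Path $0$ is a virtual ''not traveling'' alternative. Pooled day-to-day choice model. The parameters are a learning rate $\eta\in(0,1)$, a scale $\theta>0$ and a non-travel probability $\rho\in(0,1)$, common to all commuters. All commuters have the same exogenously fixed initial perceived costs $V_1(i)\in\mathbb{R}$, $i\in[M]$ (for example all zero, or free-flow travel times), known and not depending on the parameters. Perceived costs are updated by $$V_{t+1}(i)=(1-\eta)V_t(i)+\eta\, c_t(i),\qquad i\in[M].$$ The choice $X_t^n\in\{0,1,\dots,M\}$ of commuter $n$ on day $t$ has probabilities $$p_t(0)=\rho,\qquad p_t(i)=(1-\rho)\frac{e^{-\theta V_t(i)}}{\sum_{m\in[M]}e^{-\theta V_t(m)}},\quad i\in[M],$$ and choices are independent across days and commuters given the costs, so that for $x_{1:T}=(x_t^n)\in\{0,\dots,M\}^{T\times N}$, $$P(X_{1:T}=x_{1:T}\mid\eta,\theta,\rho,c_{1:T})=\prod_{n=1}^N\prod_{t=1}^T p_t(x_t^n).$$ *)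

(* Defs.v *)
From mathcomp Require Import all_boot all_order all_algebra.
From mathcomp Require Import reals sequences exp.
Set Implicit Arguments.
Unset Strict Implicit.
Unset Printing Implicit Defensive.
Import Order.TTheory GRing.Theory Num.Theory.
Local Open Scope ring_scope.

(* Days and paths are numbered from 0: index t is day t+1, and i : 'I_M is
   physical path i+1. *)

(* A cost sequence is a function on nat; over T days only c 0, ..., c (T-1)
   are costs of the model (and c (T-1) is never used for a choice). *)
Fixpoint perceived_cost (R : realType) (M : nat) (V1 : 'I_M -> R)
    (c : nat -> 'I_M -> R) (eta : R) (t : nat) (i : 'I_M) : R :=
  if t is s.+1
  then (1 - eta) * perceived_cost V1 c eta s i + eta * c s i
  else V1 i.

(* In the choice set 'I_M.+1, ord0 is "not traveling" and lift ord0 i is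
   the physical path i : 'I_M. *)
Definition choice_prob (R : realType) (M : nat) (V1 : 'I_M -> R)
    (c : nat -> 'I_M -> R) (eta theta rho : R) (t : nat) (x : 'I_M.+1) : R :=
  if unlift ord0 x is Some i then
    (1 - rho) * (expR (- theta * perceived_cost V1 c eta t i)
                 / \sum_(m < M) expR (- theta * perceived_cost V1 c eta t m))
  else rho.

(* x t n is the choice of commuter n on day t; choices are independent across
   commuters and days. *)
Definition joint_prob (R : realType) (N M T : nat) (V1 : 'I_M -> R)
    (c : nat -> 'I_M -> R) (eta theta rho : R) (x : 'M['I_M.+1]_(T, N)) : R :=
  \prod_(n < N) \prod_(t < T) choice_prob V1 c eta theta rho t (x t n).

(* Main.v *)
(** Once [rho] is read off the event that nobody ever travels, the events in
    which a single commuter travels on a single day determine every choice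
    probability, hence every product [theta * (V_t i - V_t j)]. If [t] is the
    first day on which the cost difference [c_t i - c_t j] departs from
    [D = V_1 i - V_1 j], then these products at [t], [t+1] and [t+2] determine
    in turn [theta * D], [theta * eta] and [theta * eta * (1 - eta)]. *)
Require Import Defs.
From mathcomp Require Import all_boot all_order all_algebra.
From mathcomp Require Import reals sequences exp.
From mathcomp Require Import ring.
Import Order.TTheory GRing.Theory Num.Theory.
Local Open Scope ring_scope.

Section Identifiability.
Set Implicit Arguments.
Unset Strict Implicit.

(** Expanding, [W1 e = D + e * (d - D)] and [W2 e = D + e * (f - D) + e * (1 - e) * (d - D)], so
    each further equation brings one new multiple of the nonzero [d - D]. *)
Lemma scaled_recursion_inj (F : fieldType) (D d f eta theta eta' theta' : F) :
  d != D -> eta != 0 -> theta != 0 ->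
  let W1 e := (1 - e) * D + e * d in
  let W2 e := (1 - e) * W1 e + e * f in
  theta * D = theta' * D -> theta * W1 eta = theta' * W1 eta' ->
  theta * W2 eta = theta' * W2 eta' ->
  eta = eta' /\ theta = theta'.
Proof.
move=> dD eta0 theta0 W1 W2 E0 E1 E2.
have dD0 : d - D != 0 by rewrite subr_eq0.
have te : theta * eta = theta' * eta'.
  apply: (mulIf dD0).
  transitivity (theta * W1 eta - theta * D); first by rewrite /W1; ring.
  by rewrite E1 E0 /W1; ring.
have ee : eta = eta'.
  apply: (mulIf dD0); apply: (mulfI (mulf_neq0 theta0 eta0)).
  (* This combination equals [theta * eta ^+ 2 * (d - D)] and is built only from quantities already
     matched on both sides. *)
  transitivity (theta * D + theta * eta * (f - D + d - D) - theta * W2 eta).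
    by rewrite /W2 /W1; ring.
  by rewrite E2 E0 te /W2 /W1; ring.
by split=> //; apply: (mulIf eta0); rewrite te ee.
Qed.

Variables (R : realType) (M : nat) (V1 : 'I_M -> R) (c : nat -> 'I_M -> R).

(** The pair puts the commuter first, in the nesting order of the products in [joint_prob]. With
    [y = ord0] nobody travels at all. *)
Definition single_travel (T N : nat) (t : 'I_T) (n : 'I_N) (y : 'I_M.+1) :
    'M['I_M.+1]_(T, N) :=
  \matrix_(s, m) (if (m, s) == (n, t) then y else ord0).

Lemma choice_prob0 eta theta rho t :
  choice_prob V1 c eta theta rho t ord0 = rho.
Proof. by rewrite /choice_prob unlift_none. Qed.

Lemma joint_prob_single_travel (T N : nat) (t : 'I_T) (n : 'I_N) eta theta rho
    (y : 'I_M.+1) :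
  joint_prob V1 c eta theta rho (single_travel t n y) =
  choice_prob V1 c eta theta rho t y
    * rho ^+ #|[pred p : 'I_N * 'I_T | p != (n, t)]|.
Proof.
rewrite /joint_prob pair_bigA (bigD1 (n, t)) //= mxE eqxx; congr (_ * _).
rewrite -prodr_const; apply: eq_bigr => -[m s] /= /negPf ne.
by rewrite mxE ne choice_prob0.
Qed.

(** That nobody ever travels has as probability a positive power of [rho], and such powers are
    injective on nonnegative reals. *)
Lemma joint_prob_inj_rho (T N : nat) (t : 'I_T) (n : 'I_N)
    eta theta rho eta' theta' rho' :
  0 <= rho -> 0 <= rho' ->
  (forall x : 'M['I_M.+1]_(T, N),
    joint_prob V1 c eta theta rho x = joint_prob V1 c eta' theta' rho' x) ->
  rho = rho'.
Proof.
move=> rho_ge0 rho'_ge0 /(_ (single_travel t n ord0)).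
rewrite !joint_prob_single_travel !choice_prob0 -!exprS => /eqP.
by rewrite eqrXn2 // => /eqP.
Qed.

Lemma joint_prob_inj_choice_prob (T N : nat) (t : 'I_T) (n : 'I_N)
    eta theta eta' theta' rho (y : 'I_M.+1) :
  rho != 0 ->
  (forall x : 'M['I_M.+1]_(T, N),
    joint_prob V1 c eta theta rho x = joint_prob V1 c eta' theta' rho x) ->
  choice_prob V1 c eta theta rho t y = choice_prob V1 c eta' theta' rho t y.
Proof.
move=> rho_neq0 /(_ (single_travel t n y)).
rewrite !joint_prob_single_travel; apply: mulIf.
by rewrite expf_neq0.
Qed.

(** Both [1 - rho] and the softmax denominator cancel in the ratio. *)
Lemma choice_prob_odds eta theta rho t (i j : 'I_M) :
  rho != 1 ->
  choice_prob V1 c eta theta rho t (lift ord0 i)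
    / choice_prob V1 c eta theta rho t (lift ord0 j) =
  expR (- theta * (perceived_cost V1 c eta t i - perceived_cost V1 c eta t j)).
Proof.
move=> rho_neq1; rewrite /choice_prob !liftK mulrBr expRD expRN.
set S := \sum_(m < M) _.
have S_neq0 : S != 0.
  rewrite gt_eqF // /S (bigD1 i) //= ltr_pwDl ?expR_gt0 //.
  by apply: sumr_ge0 => m _; apply: expR_ge0.
have e_neq0 := gt_eqF (expR_gt0 (- theta * perceived_cost V1 c eta t j)).
by field; rewrite S_neq0 e_neq0 subr_eq0 eq_sym rho_neq1.
Qed.

Lemma perceived_cost_diffS eta t (i j : 'I_M) :
  perceived_cost V1 c eta t.+1 i - perceived_cost V1 c eta t.+1 j =
  (1 - eta) * (perceived_cost V1 c eta t i - perceived_cost V1 c eta t j)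
    + eta * (c t i - c t j).
Proof. by rewrite /=; ring. Qed.

(** The initial difference is a fixed point of the update as long as the cost difference equals it,
    whatever [eta] is. *)
Lemma perceived_cost_diff_const eta t (i j : 'I_M) :
  (forall s, (s < t)%N -> c s i - c s j = V1 i - V1 j) ->
  perceived_cost V1 c eta t i - perceived_cost V1 c eta t j = V1 i - V1 j.
Proof.
elim: t => [//|t IHt] cV; rewrite perceived_cost_diffS IHt => [|s st].
  by rewrite cV //; ring.
by apply: cV; apply: ltnW.
Qed.

End Identifiability.

Theorem theorem1 (R : realType) (N M T : nat)
  (hN : (1 <= N)%N) (hM : (1 <= M)%N) (hT : (3 <= T)%N)
  (V1 : 'I_M -> R) (c : nat -> 'I_M -> R) (C : R)
  (hC : forall (t : nat) (i : 'I_M), (t < T)%N -> `|c t i| <= C)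
  (hvar : exists (i j : 'I_M) (t : nat),
      [/\ i != j, (t < T - 2)%N & c t i - c t j != V1 i - V1 j])
  (eta theta rho eta' theta' rho' : R)
  (heta : 0 < eta < 1) (htheta : 0 < theta) (hrho : 0 < rho < 1)
  (heta' : 0 < eta' < 1) (htheta' : 0 < theta') (hrho' : 0 < rho' < 1)
  (hP : forall x : 'M['I_M.+1]_(T, N),
      joint_prob V1 c eta theta rho x = joint_prob V1 c eta' theta' rho' x) :
  [/\ eta = eta', theta = theta' & rho = rho'].
Proof.
have [rho_gt0 rho_lt1] := andP hrho; have [rho'_gt0 _] := andP hrho'.
pose n0 := Ordinal hN; pose t0 := Ordinal (ltn_trans (isT : 0 < 2)%N hT).
have rhoE : rho = rho'.
  exact: (joint_prob_inj_rho t0 n0 (ltW rho_gt0) (ltW rho'_gt0) hP).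
subst rho'.
have [i [j [t1 [_ t1T ct1]]]] := hvar.
have scaled_diff t : (t < T)%N ->
    theta * (perceived_cost V1 c eta t i - perceived_cost V1 c eta t j) =
    theta' * (perceived_cost V1 c eta' t i - perceived_cost V1 c eta' t j).
  move=> tT; apply: oppr_inj; rewrite -!mulNr; apply: expR_inj.
  (* Read backwards, the odds formula cannot infer [rho], which is absent from the exponential; it
     is given explicitly. *)
  rewrite -!(@choice_prob_odds _ _ _ _ _ _ rho) ?lt_eqF //.
  by rewrite !(joint_prob_inj_choice_prob (Ordinal tT) n0 _
               (lt0r_neq0 rho_gt0) hP).
have exD : exists t, c t i - c t j != V1 i - V1 j by exists t1.
case: (ex_minnP exD) => t ct tmin.
(* Minimality gives [t <= t1 < T - 2], so choices are observed on all three days [t], [t + 1] and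
   [t + 2]. *)
have tT : (2 + t < T)%N.
  by rewrite -ltn_subRL; apply: leq_ltn_trans t1T; apply: tmin.
have cV s : (s < t)%N -> c s i - c s j = V1 i - V1 j.
  by move=> st; apply: contraTeq st => /tmin; rewrite -leqNgt.
move: (scaled_diff _ (ltnW (ltnW tT))) (scaled_diff _ (ltnW tT)).
move: (scaled_diff _ tT).
(* The differences at [t], [t + 1], [t + 2] become [D], [W1], [W2] of [scaled_recursion_inj], with
   [d] and [f] the cost differences of days [t] and [t + 1]. *)
rewrite !perceived_cost_diffS !(perceived_cost_diff_const _ cV).
have [eta_gt0 _] := andP heta.
move=> E2 E0 E1.
have eta_neq0 := lt0r_neq0 eta_gt0; have theta_neq0 := lt0r_neq0 htheta.
by have [] := scaled_recursion_inj ct eta_neq0 theta_neq0 E0 E1 E2.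
Qed.
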